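(* For any integrable function $f$ on $I=(0,\infty)$, there exists an $N$-function $G$ such that $G(|f|)$ is integrable on $I$.
   Context: The half-line $I=(0,\infty)$ is equipped with Lebesgue measure, and functions are real-valued and measurable. $N$-function: a continuous, convex function $G:[0,\infty)\to[0,\infty)$ such that (i) $G(0)=0$; (ii) $G(\lambda)>0$ for $\lambda>0$; (iii) $\frac{G(\lambda)}{\lambda}\to 0$ as $\lambda\to 0+$; (iv) $\frac{G(\lambda)}{\lambda}\to\infty$ as $\lambda\to\infty$. *)

(* Defs.v *)
From HB Require Import structures.
From mathcomp Require Import all_boot all_order all_algebra.
From mathcomp Require Import all_classical all_reals all_analysis.

Set Implicit Arguments.
Unset Strict Implicit.
Unset Printing Implicit Defensive.

Import Order.TTheory GRing.Theory Num.Theory numFieldNormedType.Exports.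

Local Open Scope classical_set_scope.
Local Open Scope ring_scope.

(* The domain [0, oo) is encoded by a total function whose values on negative
   reals are irrelevant. *)
Record N_function (R : realType) (G : R -> R) : Prop := NFunction {
  N_function_ge0 : forall x : R, 0 <= x -> 0 <= G x ;
  N_function_continuous : {within `[0, +oo[, continuous G} ;
  N_function_convex : convex_function (`[0, +oo[%classic : set R^o) G ;
  N_function0 : G 0 = 0 ;
  N_function_gt0 : forall x : R, 0 < x -> 0 < G x ;
  N_function_cvg0 : G x / x @[x --> 0^'+] --> 0 ;
  N_function_cvgy : G x / x @[x --> +oo] --> +oo
}.

(* Main.v *)
(** Following de la Vallée-Poussin, [G t = t^2/(1+t) + \sum_i (t - c_i)^+] with
    [c_i -> oo]. The first summand is at most [t], and it supplies positivity
    together with [G t / t -> 0] at [0]; the sum vanishes near [0], is locally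
    finite, and grows superlinearly. By dominated convergence the integral of
    [(|f| - c)^+] tends to [0] as [c -> oo], so the [c_i] can be chosen with
    these integrals bounded by [2^-(i+1)]. *)

Require Import Defs.
From HB Require Import structures.
From mathcomp Require Import all_boot all_order all_algebra.
From mathcomp Require Import all_classical all_reals all_analysis.
From mathcomp Require Import measurable_realfun ring lra.

Set Implicit Arguments.
Unset Strict Implicit.
Unset Printing Implicit Defensive.

Import Order.TTheory GRing.Theory Num.Theory numFieldNormedType.Exports.

Local Open Scope classical_set_scope.
Local Open Scope ring_scope.

(** * Hinges and their locally finite sums *)

Definition hinge (R : realType) (a t : R) : R := Num.max (t - a) 0.

Lemma hinge_ge0 (R : realType) (a t : R) : 0 <= hinge a t.
Proof. by rewrite /hinge le_max lexx orbT. Qed.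

Lemma hinge_eq0 (R : realType) (a t : R) : t <= a -> hinge a t = 0.
Proof. by move=> ta; apply/max_idPr; rewrite subr_le0. Qed.

Lemma hinge_continuous (R : realType) (a : R) : continuous (hinge a).
Proof.
move=> t; apply: (@continuous_max R R (fun s => s - a) (fun=> 0)) => /=.
  by apply: cvgB; [exact: cvg_id | exact: cvg_cst].
exact: cvg_cst.
Qed.

Lemma hinge_convex (R : realType) (a k x y : R) : 0 <= k <= 1 ->
  hinge a (k * x + (1 - k) * y) <= k * hinge a x + (1 - k) * hinge a y.
Proof.
move=> /andP[k0 k1]; have k1' : 0 <= 1 - k by rewrite subr_ge0.
rewrite /hinge ge_max; apply/andP; split.
  have -> : k * x + (1 - k) * y - a = k * (x - a) + (1 - k) * (y - a) by ring.
  by apply: lerD; rewrite ler_wpM2l// le_max lexx.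
by apply: addr_ge0; rewrite mulr_ge0// -/(hinge _ _) hinge_ge0.
Qed.

(** Stands for the sum over all [i]. When [i < c i] for all [i], an index [i >= truncn t] has
    [t < i + 1 <= c i], so only zero terms are cut off and no limit is involved. *)
Definition hinge_series (R : realType) (c : nat -> nat) (t : R) : R :=
  \sum_(0 <= i < Num.truncn t) hinge (c i)%:R t.

(* The hinges beyond the truncation in [hinge_series] vanish at [t]. *)
Lemma hinge_seriesE (R : realType) (c : nat -> nat) (N : nat) (t : R) :
  (forall i, (i < c i)%N) -> t < N.+1%:R ->
  hinge_series c t = \sum_(0 <= i < N) hinge (c i)%:R t.
Proof.
move=> ic tN; rewrite /hinge_series.
have tN' : (Num.truncn t <= N)%N by rewrite truncn_le_nat.
rewrite [RHS](big_cat_nat (n := Num.truncn t))//=.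
rewrite -[LHS]addr0; congr (_ + _); rewrite big_nat big1// => i /andP[ti _].
apply: hinge_eq0; apply: ltW; apply: lt_le_trans (truncnS_gt t) _.
by rewrite ler_nat (leq_trans _ (ic i)).
Qed.

Lemma hinge_series_ge0 (R : realType) (c : nat -> nat) (t : R) :
  0 <= hinge_series c t.
Proof. by apply: sumr_ge0 => i _; exact: hinge_ge0. Qed.

(** The range [truncn t] jumps at integers, but the strict bound [t < N] persists near [t], so one
    fixed finite sum represents the series on a whole neighbourhood. *)
Lemma hinge_series_continuous (R : realType) (c : nat -> nat) :
  (forall i, (i < c i)%N) -> continuous (@hinge_series R c).
Proof.
move=> ic t; pose N := (Num.truncn t).+1.
have tN : t < N%:R by exact: truncnS_gt.
have nbE : \forall s \near t,
    \sum_(0 <= i < N) hinge (c i)%:R s = hinge_series c s.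
  have := lt_nbhsl tN; apply: filterS => s sN.
  by rewrite (hinge_seriesE (N := N))// (lt_trans sN)// ltr_nat.
rewrite /continuous_at.
have -> : hinge_series c t = \sum_(0 <= i < N) hinge (c i)%:R t.
  by apply: hinge_seriesE => //; rewrite (lt_trans tN)// ltr_nat.
apply: (cvg_trans (near_eq_cvg nbE)).
by apply: cvg_big => [|i _]; [exact: add_continuous|exact: hinge_continuous].
Qed.

(** Convexity is termwise once the three values are sums over one range; a bound for [max x y] also
    bounds the convex combination. *)
Lemma hinge_series_convex (R : realType) (c : nat -> nat) (k x y : R) :
  (forall i, (i < c i)%N) -> 0 <= k <= 1 ->
  hinge_series c (k * x + (1 - k) * y) <=
  k * hinge_series c x + (1 - k) * hinge_series c y.
Proof.
move=> ic k01; pose M := Num.max x y; pose N := Num.truncn M.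
have MN : M < N.+1%:R by exact: truncnS_gt.
have xM : x <= M by rewrite le_max lexx.
have yM : y <= M by rewrite le_max lexx orbT.
have zM : k * x + (1 - k) * y <= M.
  by move: k01 => /andP[k0 k1]; nra.
rewrite !(hinge_seriesE (N := N))//; [|exact: le_lt_trans MN ..].
rewrite !mulr_sumr -big_split/=; apply: ler_sum => i _.
exact: hinge_convex.
Qed.

Lemma hinge_series_eq0 (R : realType) (c : nat -> nat) (t : R) : t < 1 ->
  hinge_series c t = 0.
Proof.
move=> t1; have : (Num.truncn t <= 0)%N by rewrite truncn_le_nat.
by rewrite leqn0 /hinge_series => /eqP ->; rewrite big_nil.
Qed.

(** The first [n > A] hinges alone sum to at least [n * t - C], which is at least [A * t] once
    [t >= C / (n - A)]. *)
Lemma hinge_series_superlinear (R : realType) (c : nat -> nat) (A : R) :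
  (forall i, (i < c i)%N) ->
  \forall t \near +oo, A * t <= hinge_series c t.
Proof.
move=> ic; pose n := (Num.truncn A).+1.
pose C : R := \sum_(0 <= i < n) (c i)%:R.
have An : 0 < n%:R - A by rewrite subr_gt0 truncnS_gt.
near=> t.
(* This puts all of the first [n] hinges inside the truncated sum at [t]. *)
have tn : n%:R <= t by near: t; apply: nbhs_pinfty_ge; rewrite num_real.
have tC : C / (n%:R - A) <= t by near: t; apply: nbhs_pinfty_ge; rewrite num_real.
have ntC : n%:R * t - C <= \sum_(0 <= i < n) hinge (c i)%:R t.
  rewrite mulr_natl -{1}(subn0 n) -sumr_const_nat -sumrB.
  by apply: ler_sum => i _; rewrite le_max lexx.
rewrite ler_pdivrMr// in tC.
apply: (@le_trans _ _ (n%:R * t - C)); first by lra.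
apply: (le_trans ntC); rewrite (hinge_seriesE ic (truncnS_gt t)).
have nt : (n <= Num.truncn t)%N.
  by rewrite truncn_gt_nat.
rewrite [leRHS](big_cat_nat (n := n))//= lerDl.
by apply: sumr_ge0 => i _; exact: hinge_ge0.
Unshelve. all: by end_near. Qed.

(** * The summand governing the behaviour at 0 *)

(* [t^2 / (1 + t)] on [0, +oo[; the absolute value only makes the extension to
   negative [t] continuous. *)
Definition quad_lin (R : realType) (t : R) : R := t ^+ 2 / (1 + `|t|).

Lemma quad_lin_den_gt0 (R : realType) (t : R) : 0 < 1 + `|t|.
Proof. by rewrite ltr_pwDl. Qed.

Lemma quad_lin_ge0 (R : realType) (t : R) : 0 <= quad_lin t.
Proof. by rewrite divr_ge0 ?sqr_ge0// ltW ?quad_lin_den_gt0. Qed.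

Lemma quad_lin_gt0 (R : realType) (t : R) : 0 < t -> 0 < quad_lin t.
Proof. by move=> t0; rewrite divr_gt0 ?exprn_gt0 ?quad_lin_den_gt0. Qed.

Lemma quad_lin_le (R : realType) (t : R) : 0 <= t -> quad_lin t <= t.
Proof.
move=> t0; rewrite ler_pdivrMr ?quad_lin_den_gt0// ger0_norm//; nra.
Qed.

Lemma quad_lin_continuous (R : realType) : continuous (@quad_lin R).
Proof.
move=> t; apply: cvgM; first exact: exprn_continuous.
apply: cvgV; first by rewrite gt_eqF ?quad_lin_den_gt0.
by apply: cvgD; [exact: cvg_cst | exact: norm_continuous].
Qed.

(** An affine function plus a reciprocal: convexity reduces to that of [1 / (1 + t)]. *)
Lemma quad_linE (R : realType) (t : R) : 0 <= t ->
  quad_lin t = t - 1 + (1 + t)^-1.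
Proof.
move=> t0; rewrite /quad_lin ger0_norm//; field.
by rewrite gt_eqF// ltr_pwDl.
Qed.

Lemma quad_lin_convex (R : realType) (k x y : R) :
  0 <= x -> 0 <= y -> 0 <= k <= 1 ->
  quad_lin (k * x + (1 - k) * y) <= k * quad_lin x + (1 - k) * quad_lin y.
Proof.
move=> x0 y0 /andP[k0 k1].
have k1' : 0 <= 1 - k by rewrite subr_ge0.
have z0 : 0 <= k * x + (1 - k) * y by rewrite addr_ge0// mulr_ge0.
rewrite !quad_linE// -subr_ge0.
have X0 : 0 < 1 + x by rewrite ltr_pwDl.
have Y0 : 0 < 1 + y by rewrite ltr_pwDl.
have Z0 : 0 < 1 + (k * x + (1 - k) * y) by rewrite ltr_pwDl.
(* The affine parts cancel, and the convexity gap of [1 / (1 + t)] has a closed form whose factors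
   are all nonnegative. *)
rewrite (_ : _ - _ = k * (1 - k) * (x - y) ^+ 2 /
  ((1 + x) * (1 + y) * (1 + (k * x + (1 - k) * y)))).
  apply: divr_ge0; first by rewrite mulr_ge0 ?sqr_ge0// mulr_ge0.
  by rewrite ltW// !mulr_gt0.
by field; rewrite !gt_eqF.
Qed.

(** * The N-function properties of the sum *)

Lemma N_function_quad_lin_hinge_series (R : realType) (c : nat -> nat) :
  (forall i, (i < c i)%N) ->
  N_function (fun t : R => quad_lin t + hinge_series c t).
Proof.
move=> ic; split.
- by move=> t _; rewrite addr_ge0 ?quad_lin_ge0 ?hinge_series_ge0.
- apply: continuous_subspaceT => t.
  by apply: cvgD; [exact: quad_lin_continuous|exact: hinge_series_continuous].
- move=> k x y; rewrite !inE/= !in_itv/= !andbT => x0 y0.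
  have k01 : 0 <= k%:num <= 1 by rewrite ge0 le1.
  apply: le_trans (lerD (quad_lin_convex x0 y0 k01)
    (hinge_series_convex x y ic k01)) _.
  by rewrite convRE /unstable.onem 2!mulrDr addrACA.
- by rewrite /quad_lin hinge_series_eq0// expr0n/= mul0r addr0.
- by move=> t t0; rewrite ltr_pwDl ?quad_lin_gt0 ?hinge_series_ge0.
(* For [0 < t < 1] the series vanishes and the ratio is [t / (1 + t)], squeezed between [0] and
   [t]. *)
- apply: (@squeeze_cvgr _ _ _ _ (fun=> 0) id).
  + near=> t; have t0 : 0 < t by near: t; exact: nbhs_right_gt.
    rewrite hinge_series_eq0 ?addr0; last first.
      by near: t; apply: nbhs_right_lt.
    rewrite divr_ge0 ?quad_lin_ge0 ?(ltW t0)//= ler_pdivrMr//.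
    rewrite ler_pdivrMr ?quad_lin_den_gt0// -expr2 ler_peMr ?sqr_ge0//.
    by rewrite lerDl.
  + exact: cvg_cst.
  + by apply: cvg_at_right_filter; exact: cvg_id.
- apply/cvgryPge => A; near=> t.
  have t0 : 0 < t by near: t; apply: nbhs_pinfty_gt; rewrite num_real.
  rewrite ler_pdivlMr//; apply: (@le_trans _ _ (hinge_series c t)).
    by near: t; exact: hinge_series_superlinear.
  by rewrite lerDr quad_lin_ge0.
Unshelve. all: by end_near. Qed.

(** * Choice of the kinks and integrability *)

(** Dominated convergence with majorant [|g|]: at each [x] the hinge is zero as soon as
    [n >= g x]. *)
Lemma integral_hinge_cvg0 d (T : measurableType d) (R : realType)
    (mu : {measure set T -> \bar R}) (D : set T) (g : T -> R) :
  measurable D -> mu.-integrable D (EFin \o g) ->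
  (\int[mu]_(x in D) (hinge n%:R (g x))%:E @[n --> \oo] --> 0)%E.
Proof.
move=> mD ig.
have mg : measurable_fun D g by apply/measurable_EFinP; exact: measurable_int ig.
have [|||||_ _ +] := @dominated_convergence _ _ _ mu D mD
    (fun n x => (hinge n%:R (g x))%:E) (cst 0%E) (fun x => `|(g x)%:E|%E).
- move=> n; apply/measurable_EFinP; apply: measurableT_comp mg.
  exact: continuous_measurable_fun (@hinge_continuous _ _).
- exact: measurable_cst.
- apply: aeW => x _; apply: cvg_near_cst; near=> n; congr (_%:E).
  by apply: hinge_eq0; near: n; exact: nbhs_infty_ger.
- exact: integrable_abse.
- apply: aeW => x n _; rewrite /= lee_fin ger0_norm ?hinge_ge0//.
  rewrite ge_max normr_ge0 andbT.
  by rewrite (le_trans _ (ler_norm _))// lerBlDr lerDl.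
by rewrite integral0.
Unshelve. all: by end_near. Qed.

(** Both requirements hold for all large [n]: the first makes the series locally finite, the second
    makes the integrals summable. *)
Lemma exists_summable_hinges d (T : measurableType d) (R : realType)
    (mu : {measure set T -> \bar R}) (D : set T) (g : T -> R) :
  measurable D -> mu.-integrable D (EFin \o g) ->
  exists c : nat -> nat, forall i, (i < c i)%N /\
    (\int[mu]_(x in D) (hinge (c i)%:R (g x))%:E <= (1 / (2 ^ i.+1)%:R)%:E)%E.
Proof.
move=> mD ig; suff /choice[c cP] : forall i, exists n : nat, (i < n)%N /\
    (\int[mu]_(x in D) (hinge n%:R (g x))%:E <= (1 / (2 ^ i.+1)%:R)%:E)%E.
  by exists c.
move=> i.
have e0 : 0 < 1 / (2 ^ i.+1)%:R :> R by rewrite divr_gt0// ltr0n expn_gt0.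
(* The limit is taken in the extended reals: [fin] says that the integrals are eventually finite,
   [small] that their real values drop below the bound. *)
have /fine_cvgP[fin /cvgr_lt/(_ _ e0) small] := integral_hinge_cvg0 mD ig.
near \oo => n; exists n; split; first by near: n; exact: nbhs_infty_gt.
rewrite -[leLHS]fineK ?lee_fin; first by apply: ltW; near: n.
by near: n.
Unshelve. all: by end_near. Qed.

Lemma exists_N_function_integrable d (T : measurableType d) (R : realType)
    (mu : {measure set T -> \bar R}) (D : set T) (f : T -> R) :
  measurable D -> mu.-integrable D (EFin \o f) ->
  exists G : R -> R,
    N_function G /\ mu.-integrable D (fun x => (G `|f x|)%:E).
Proof.
move=> mD intf; pose g x := `|f x|.
have ig : mu.-integrable D (EFin \o g) by exact: integrable_abse intf.
have mg : measurable_fun D g by apply/measurable_EFinP; exact: measurable_int ig.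
have [c /all_and2[ic intc]] := exists_summable_hinges mD ig.
have mcomp (h : R -> R) : continuous h -> measurable_fun D (EFin \o (h \o g)).
  move=> ch; apply/measurable_EFinP; apply: measurableT_comp mg.
  exact: continuous_measurable_fun.
exists (fun t => quad_lin t + hinge_series c t); split.
  exact: N_function_quad_lin_hinge_series.
apply: (@integrableD _ _ _ mu D mD (EFin \o (@quad_lin R \o g))
  (EFin \o (hinge_series c \o g))).
  apply: le_integrable ig => //; first exact/mcomp/quad_lin_continuous.
  move=> x _; rewrite /= lee_fin ger0_norm ?quad_lin_ge0// normr_id.
  exact/quad_lin_le/normr_ge0.
apply/integrableP; split; first exact/mcomp/hinge_series_continuous.
(* The length of the finite sum depends on [x]; bounding it by the full series of nonnegative terms
   allows integration term by term. *)
apply: (@le_lt_trans _ _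
  (\int[mu]_(x in D) \sum_(0 <= i <oo) (hinge (c i)%:R (g x))%:E)%E).
  apply: ge0_le_integral => //.
  - by apply: measurableT_comp => //; exact/mcomp/hinge_series_continuous.
  - apply: ge0_emeasurable_sum => i.
      by move=> x _ _; rewrite lee_fin hinge_ge0.
    by move=> _; apply: mcomp (@hinge_continuous _ _).
  - move=> x _; rewrite /= ger0_norm ?hinge_series_ge0// -sumEFin.
    by apply: nneseries_lim_ge => i _ _; rewrite lee_fin hinge_ge0.
rewrite integral_nneseries//; last 2 first.
- by move=> i; exact: mcomp (@hinge_continuous _ _).
- by move=> i x _; rewrite lee_fin hinge_ge0.
(* The geometric majorant has total at most [1]. *)
apply: (@le_lt_trans _ _ (\sum_(0 <= i <oo) (1 / (2 ^ i.+1)%:R)%:E)%E).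
  apply: lee_nneseries => i// _ _.
  by apply: integral_ge0 => x _; rewrite lee_fin hinge_ge0.
by apply: le_lt_trans (epsilon_trick0 _ ler01) _; rewrite ltry.
Qed.

Theorem lemma3p1 (R : realType) (f : R -> R)
    (hf : (@completed_lebesgue_measure R).-integrable `]0, +oo[
            (fun x => (f x)%:E)) :
  exists G : R -> R,
    N_function G /\
    (@completed_lebesgue_measure R).-integrable `]0, +oo[
      (fun x => (G `|f x|)%:E).
Proof.
apply: exists_N_function_integrable hf.
(* The half-line is Borel, hence Carathéodory measurable, as the completed measure requires. *)
apply: sub_caratheodory; exact: measurable_itv.
Qed.
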